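(* Let $\alpha\in[0,1]$, $\rho>0$, and let $a_0(n),a_1(n)$ be convergent real sequences with limits $l_i=\lim_{n\to\infty}a_i(n)$, $i=0,1$, such that for every $n$ $$2a_0(n)+a_1(n)=1,\qquad a_0(n)\ge 0,\qquad a_0(n)+a_1(n)\ge 0 .$$ If $f$ is twice differentiable on $[0,1]$ with $f''\in C[0,1]$, then $$\lim_{n\to\infty}n\bigl(J_{n,\alpha,\rho}^{M,1}(f;x)-f(x)\bigr)=\frac{(1-2x)\bigl((\rho+2)l_0+(\rho+1)l_1\bigr)}{\rho}f'(x)+\frac{x(1-x)(1+\rho)(2l_0+l_1)}{2\rho}f''(x)$$ uniformly on $[0,1]$.
   Context: Fix $\alpha\in[0,1]$ and $\rho>0$. For $x\in[0,1]$ let $p_{1,0,\alpha}(x)=1-x$, $p_{1,1,\alpha}(x)=x$, and for $m\ge 2$, $0\le k\le m$, $$p_{m,k,\alpha}(x)=\left[\binom{m-2}{k}(1-\alpha)x+\binom{m-2}{k-2}(1-\alpha)(1-x)+\binom{m}{k}\alpha x(1-x)\right]x^{k-1}(1-x)^{m-k-1}$$ (understood as a polynomial in $x$, with $\binom{r}{s}=0$ if $s<0$ or $s>r$); $p_{m,k,\alpha}=0$ if $k<0$ or $k>m$. Let $$\mu_{n,k}^\rho(t)=\frac{t^{k\rho}(1-t)^{(n-k)\rho}}{B(k\rho+1,(n-k)\rho+1)},\quad t\in[0,1],$$ where $B$ is the Beta function. Given real sequences $a_0(n),a_1(n)$, put $a(x,n)=a_1(n)x+a_0(n)$ and, for $n\ge2$,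 $$J_{n,\alpha,\rho}^{M,1}(f;x)=\sum_{k=0}^n\bigl[a(x,n)\,p_{n-1,k,\alpha}(x)+a(1-x,n)\,p_{n-1,k-1,\alpha}(x)\bigr]\int_0^1\mu_{n,k}^\rho(t)f(t)\,dt .$$ *)

(* Defs.v *)
From HB Require Import structures.
From mathcomp Require Import all_boot all_order all_algebra.
From mathcomp Require Import all_classical all_reals all_analysis.
From mathcomp Require Import ring.

Set Implicit Arguments.
Unset Strict Implicit.
Unset Printing Implicit Defensive.

Import Order.TTheory GRing.Theory Num.Theory.
Import numFieldNormedType.Exports.

Local Open Scope classical_set_scope.
Local Open Scope ring_scope.

Definition binz (r : nat) (s : int) : nat :=
  if s is Posz j then 'C(r, j) else 0.

(* [bernstein_alpha alpha m k] is the polynomial function which, for m >= 2 and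
   0 <= k <= m, is given off {0, 1} by
     (C(m-2,k)(1-alpha)x + C(m-2,k-2)(1-alpha)(1-x) + C(m,k) alpha x(1-x))
       * x^(k-1) (1-x)^(m-k-1),
   see [bernstein_alphaE]. The last factor has negative exponents when k = 0 or
   k = m, so it is multiplied through here; the truncated exponents m - k - 1
   and k - 1 only truncate where the binomial in front of them is 0.
   The value for m = 0 is a dummy. *)
Definition bernstein_alpha (R : realType) (alpha : R) (m : nat) (k : int)
    (x : R) : R :=
  match m, k with
  | _, Negz _ => 0
  | 0, Posz _ => 0
  | 1, Posz 0 => 1 - x
  | 1, Posz 1 => x
  | 1, Posz _ => 0
  | r.+2, Posz j =>
    if (m < j)%N then 0 else
      (binz r k)%:R * (1 - alpha) * (x ^+ j * (1 - x) ^+ (m - j - 1))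
    + (binz r (k - 2))%:R * (1 - alpha) * (x ^+ (j - 1) * (1 - x) ^+ (m - j))
    + 'C(m, j)%:R * alpha * (x ^+ j * (1 - x) ^+ (m - j))
  end.

Lemma bernstein_alphaE (R : realType) (alpha : R) (r j : nat) (x : R) :
  let m := r.+2 in let k := j%:Z in
  (j <= m)%N -> x != 0 -> x != 1 ->
  bernstein_alpha alpha m k x =
    ((binz r k)%:R * (1 - alpha) * x
     + (binz r (k - 2))%:R * (1 - alpha) * (1 - x)
     + (binz m k)%:R * alpha * x * (1 - x))
    * x ^ (k - 1) * (1 - x) ^ (m%:Z - k - 1).
Proof.
move=> m k jm x0 x1; rewrite /bernstein_alpha /k /m /= ltnNge jm /=.
have y0 : 1 - x != 0 by rewrite subr_eq0 eq_sym.
have Ex : x ^ (j%:Z - 1) = x ^+ j / x by rewrite expfzDr.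
have Ey : (1 - x) ^ (r.+2%:Z - j%:Z - 1) = (1 - x) ^+ (r.+2 - j) / (1 - x).
  by rewrite expfzDr // subzn.
rewrite Ex Ey !mulrDl; congr (_ + _ + _).
- have [jr|jr] := leqP j r; last by rewrite bin_small // !mul0r.
  have -> : (r.+2 - j)%N = (r.+2 - j - 1).+1.
    by rewrite subn1 prednK // subn_gt0 (leq_ltn_trans jr).
  by rewrite subn1 /= exprSr; field; rewrite ?x0 ?y0.
- case: j jm k Ex Ey => [|[|j]] jm k Ex Ey;
    [by rewrite /= !mul0r|by rewrite /= !mul0r|].
  set c := (binz r _)%:R; set d := (1 - x) ^+ _.
  by rewrite [(j.+2 - 1)%N]subn1 [j.+2.-1]/= [x ^+ j.+2]exprSr; field; rewrite ?x0 ?y0.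
- by rewrite /=; field; rewrite ?x0 ?y0.
Qed.

(* The library's [beta_fun] only covers natural arguments. *)
Definition Beta (R : realType) (a b : R) : R :=
  (\int[@lebesgue_measure R]_(t in `[0%R, 1%R])
     (t `^ (a - 1) * (1 - t) `^ (b - 1)))%R.

Definition mu_rho (R : realType) (rho : R) (n k : nat) (t : R) : R :=
  t `^ (k%:R * rho) * (1 - t) `^ ((n - k)%:R * rho)
  / Beta (k%:R * rho + 1) ((n - k)%:R * rho + 1).

Definition acoef (R : realType) (a0 a1 : R^nat) (x : R) (n : nat) : R :=
  a1 n * x + a0 n.

(* Only meaningful for n >= 2. *)
Definition JM1 (R : realType) (alpha rho : R) (a0 a1 : R^nat) (n : nat)
    (f : R -> R) (x : R) : R :=
  \sum_(k < n.+1)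
    (acoef a0 a1 x n * bernstein_alpha alpha n.-1 k%:Z x
     + acoef a0 a1 (1 - x) n * bernstein_alpha alpha n.-1 (k%:Z - 1) x)
    * (\int[@lebesgue_measure R]_(t in `[0%R, 1%R]) (mu_rho rho n k t * f t))%R.

(* f has derivative f' at every point of A, the difference quotients being
   restricted to A; hence one-sided derivatives at the endpoints of an
   interval. *)
Definition has_derivative_on (R : realType) (A : set R) (f f' : R -> R) : Prop :=
  forall x, A x -> (f y - f x) / (y - x) @[y --> within A x^'] --> f' x.

(* Main.v *)
Require Import Defs.
From HB Require Import structures.
From mathcomp Require Import all_boot all_order all_algebra.
From mathcomp Require Import all_classical all_reals all_analysis.
From mathcomp Require Import ring lra.

(** The operator is an expectation.  With weights given by the modified
    alpha-Bernstein basis choose a random index [k], then choose [t] from the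
    Beta density [mu_rho rho n k]; [JM1 alpha rho a0 a1 n f x] is the mean of
    [f t].  Both layers concentrate: [k / n] is within O(1 / sqrt n) of [x] and
    [t] is within O(1 / sqrt n) of [k / n].  So Taylor's formula at [x],
    truncated at order two, yields
      J f x - f x = f' x * J (t - x) + f'' x / 2 * J ((t - x)^2) + remainder,
    and the theorem reads off the limits of [n] times the first two central
    moments, while [n] times the remainder vanishes uniformly.

    The index: the modified basis is a binomial law with [r = n - 3] trials
    followed by an independent jump in {0, 1, 2, 3} ([JM1_index_mean], from
    [sum_bernstein_alpha]).  The jump only
    affects lower-order terms, so the first two moments of [k - n x] follow from
    those of the binomial law ([binomial_mean_quartic]), with mean [b - x],
    where [b] is the weight [acoef a0 a1 (1 - x) n], and variance [n x (1 - x)]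
    up to O(1); the fourth moment is O(n^2) ([index_mean_fourth]).

    The Beta layer: integrating the derivative of [t^(a+1) (1-t)^(b+1)] gives a
    two-term recursion for the Beta integrals with real parameters
    ([beta_integral_rec]), hence for the moments of [mu_rho].  It yields the
    first two moments about [x] exactly and a bound O(1 / n^2) for the fourth
    one about [k / n] ([beta_avg_fourth_mean]).

    The remainder: two applications of the mean value theorem bound it by
    [|f'' d - f'' x| (t - x)^2] with [d] between [x] and [t]; since [f''] is
    uniformly continuous and bounded, this is at most
    [e (t - x)^2 + C (t - x)^4] for any [e > 0] and a [C] depending on [e] only
    ([taylor2_bound]).  As [n J ((t - x)^2)] is bounded and
    [n J ((t - x)^4) = O(1 / n)], the remainder contributes at most a constant
    times [e] in the limit.  All estimates are collected, with explicit
    constants independent of [x], in [JM1_error_bound]. *)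

Set Implicit Arguments.
Unset Strict Implicit.
Unset Printing Implicit Defensive.

Import Order.TTheory GRing.Theory Num.Theory.
Import numFieldNormedType.Exports.

Local Open Scope classical_set_scope.
Local Open Scope ring_scope.

(** * Second-order Taylor expansion on a closed interval *)

Lemma has_derivative_on_continuous {R : realType} (a b : R) (f f' : R -> R) :
  has_derivative_on `[a, b] f f' -> {within `[a, b], continuous f}.
Proof.
move=> df; apply/subspace_continuousP => x abx.
have dfx := df x abx.
have : f y - f x @[y --> within `[a, b] x^'] --> 0.
  have -> : 0 = f' x * (x - x) by rewrite subrr mulr0.
  apply: (@cvg_trans _ ((f y - f x) / (y - x) * (y - x) @[y --> within `[a, b] x^'])).
    apply: near_eq_cvg.
    rewrite /= near_withinE; near=> y => _.
    rewrite divfK // subr_eq0; near: y; exact: nbhs_dnbhs_neq.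
  apply: cvgM => //; apply: cvgB; last exact: cvg_cst.
  by apply: cvg_within_filter; exact: cvg_within.
move=> /cvgrPdist_lt fx; apply/cvgrPdist_lt => e e0.
have := fx e e0; rewrite !near_withinE.
apply: filterS => y h aby; have [->|yx] := eqVneq y x; first by rewrite subrr normr0.
by have := h yx aby; rewrite sub0r opprB.
Unshelve. all: by end_near. Qed.

Lemma has_derivative_on_is_derive {R : realType} (a b : R) (f f' : R -> R) (x : R) :
  has_derivative_on `[a, b] f f' -> x \in `]a, b[ -> is_derive x 1 f (f' x).
Proof.
move=> df xab.
have axb : x \in `[a, b] by exact: subset_itv_oo_cc.
have H : h^-1 *: ((f \o shift x) (h *: 1) - f x) @[h --> 0^'] --> f' x.
  apply/cvgrPdist_lt => e e0.
  have /cvgrPdist_lt /(_ e e0) := df x axb; rewrite !near_withinE => dfx.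
  have : \forall y \near x, y != x -> `|f' x - (f y - f x) / (y - x)| < e.
    near=> y => yx.
    have : y != x -> y \in `[a, b] -> `|f' x - (f y - f x) / (y - x)| < e by near: y.
    apply => //; apply: subset_itv_oo_cc; near: y; exact: near_in_itvoo.
  rewrite (near_shift 0); apply: filterS => h /=; rewrite subr0 => hx h0.
  have := hx _; rewrite -subr_eq0 addrK => /(_ h0).
  by rewrite [h *: 1](_ : _ = h) 1?mulrC // /GRing.scale /= mulr1.
apply: DeriveDef; first by apply/cvg_ex; exists (f' x).
exact: cvg_lim.
Unshelve. all: by end_near. Qed.

(** Heine's theorem, by the covering form of compactness: near each point the
    half of a continuity radius works as a uniform radius. *)
Lemma uniform_modulus {R : realType} (a b : R) (g : R -> R) (e : R) :
  {within `[a, b], continuous g} -> 0 < e ->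
  exists2 d : R, 0 < d & forall x y, x \in `[a, b] -> y \in `[a, b] -> `|x - y| < d ->
     `|g x - g y| <= e.
Proof.
move=> /subspace_continuousP cg e0.
pose P (d x : R) := forall y, y \in `[a, b] -> `|x - y| < d -> `|g x - g y| <= e.
have : \forall d \near (0 : R)^'+, `[a, b] `<=` P d.
  have /compact_near_coveringP/near_covering_withinP := @segment_compact R a b.
  apply=> x abx.
  have e2 : 0 < e / 2 by rewrite divr_gt0.
  have /cvgrPdist_lt /(_ _ e2) := cg x abx.
  rewrite near_withinE => /nbhs_ballP[r /= r0 xr].
  exists (ball x (r / 2), [set d | d < r / 2]) => /=.
    split; first by apply: nbhsx_ballx; rewrite divr_gt0.
    by apply: nbhs_right_lt; rewrite divr_gt0.
  move=> [x' d] /= [xx' dr] abx' y aby x'y.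
  rewrite -ball_normE /= in xx'.
  have h1 : `|g x - g x'| < e / 2.
    by apply: xr => //; rewrite -ball_normE /=; apply: lt_trans xx' _; lra.
  have h2 : `|g x - g y| < e / 2.
    apply: xr => //; rewrite -ball_normE /=.
    have := ler_normD (x - x') (x' - y); rewrite subrKA => /le_lt_trans; apply.
    by lra.
  have := ler_normD (g x' - g x) (g x - g y); rewrite subrKA => /le_trans; apply.
  by rewrite distrC; lra.
move=> [d /= d0 H]; exists (d / 2); first by rewrite divr_gt0.
move=> x y abx aby xy; apply: (H (d / 2)) => //=; last by rewrite divr_gt0.
by rewrite sub0r normrN gtr0_norm ?divr_gt0 //; lra.
Qed.

Lemma within_bounded {R : realType} (a b : R) (g : R -> R) :
  a <= b -> {within `[a, b], continuous g} ->
  exists2 M : R, 0 < M & forall x, x \in `[a, b] -> `|g x| <= M.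
Proof.
move=> ab cg.
have cn : {within `[a, b], continuous (fun x => `|g x|)}.
  by move=> x; apply: cvg_norm; exact: cg.
have [c _ hc] := EVT_max ab cn.
exists (`|g c| + 1); first by rewrite ltr_wpDl.
by move=> x /hc h; rewrite (le_trans h) // lerDl.
Qed.

(** The modulus of continuity is traded for a quadratic: for close points the
    difference is at most [e], and for distant ones the quadratic term alone
    bounds the oscillation of [g].  This makes the remainder of the Taylor
    formula a polynomial in [t - x], which the operator can be evaluated on. *)
Lemma quadratic_modulus {R : realType} (a b : R) (g : R -> R) (e : R) :
  a <= b -> {within `[a, b], continuous g} -> 0 < e ->
  exists2 C : R, 0 < C & forall x y, x \in `[a, b] -> y \in `[a, b] ->
     `|g x - g y| <= e + C * (x - y) ^+ 2.
Proof.
move=> ab cg e0; have [d d0 hd] := uniform_modulus cg e0.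
have [M M0 hM] := within_bounded ab cg.
(* [2 M] bounds the oscillation, and [d^2 <= (x - y)^2] for distant points. *)
exists (2 * M / d ^+ 2); first by rewrite divr_gt0 ?exprn_gt0 // mulr_gt0.
move=> x y abx aby; have C0 : 0 < 2 * M / d ^+ 2 by rewrite divr_gt0 ?exprn_gt0 // mulr_gt0.
have [xy|xy] := ltP `|x - y| d.
  by rewrite (le_trans (hd _ _ abx aby xy)) // lerDl mulr_ge0 ?sqr_ge0 // ltW.
have : 2 * M <= 2 * M / d ^+ 2 * (x - y) ^+ 2.
  rewrite mulrAC ler_pdivlMr ?exprn_gt0 // ler_pM2l ?mulr_gt0 //.
  by rewrite -[X in _ <= X]real_normK ?num_real // ler_sqr ?nnegrE // ltW.
have := ler_normB (g x) (g y); have := hM _ abx; have := hM _ aby.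
lra.
Qed.

(** The mean value theorem without an order on the endpoints, which is what
    lets it be iterated. *)
Lemma mvt_between {R : realType} (a b : R) (g g' : R -> R) (x t : R) :
  {within `[a, b], continuous g} ->
  (forall s, s \in `]a, b[ -> is_derive s 1 g (g' s)) ->
  x \in `[a, b] -> t \in `[a, b] ->
  exists c, [/\ c \in `[a, b], `|c - x| <= `|t - x| &
    g t - g x = g' c * (t - x)].
Proof.
move=> cg dg.
have main u v : u \in `[a, b] -> v \in `[a, b] -> u <= v ->
    exists2 c, c \in `[u, v] & g v - g u = g' c * (v - u).
  move=> uab vab uv; have := uab; have := vab.
  rewrite !in_itv => /andP[av vb] /andP[au ub].
  have dguv s : s \in `]u, v[%R -> is_derive s 1 g (g' s).
    rewrite in_itv => /andP[us sv]; apply: dg.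
    by rewrite in_itv /= (le_lt_trans au us) (lt_le_trans sv vb).
  have cguv : {within `[u, v], continuous g}.
    apply: continuous_subspaceW cg => s /=; rewrite !in_itv => /andP[us sv].
    by rewrite /= (le_trans au us) (le_trans sv vb).
  exact: (MVT_segment uv dguv cguv).
move=> xab tab; have := xab; have := tab; rewrite !in_itv /= => /andP[at_ tb] /andP[ax xb].
have [xt|tx] := leP x t.
  have [c] := main _ _ xab tab xt; rewrite in_itv /= => /andP[xc ct] E.
  exists c; split=> //; first by rewrite in_itv /= (le_trans ax xc) (le_trans ct tb).
  by rewrite !ger0_norm ?subr_ge0 // lerD2r.
have [c] := main _ _ tab xab (ltW tx); rewrite in_itv /= => /andP[tc cx] E.
exists c; split=> //; first by rewrite in_itv /= (le_trans at_ tc) (le_trans cx xb).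
  by rewrite !ler0_norm ?subr_le0 ?(ltW tx) // lerN2 lerD2r.
by rewrite -opprB E -mulrN opprB.
Qed.

(** The mean value theorem for [f] minus its Taylor polynomial brings down one
    factor [t - x] and leaves a first-order increment of [f'], to which it
    applies again.  The sharp remainder has an additional factor 1/2, which
    the smallness of [f'' d - f'' x] makes irrelevant. *)
Lemma taylor2_remainder {R : realType} (a b : R) (f f' f'' : R -> R) (x t : R) :
  has_derivative_on `[a, b] f f' -> has_derivative_on `[a, b] f' f'' ->
  x \in `[a, b] -> t \in `[a, b] ->
  exists d, [/\ d \in `[a, b], `|d - x| <= `|t - x| &
   `|f t - f x - f' x * (t - x) - f'' x / 2 * (t - x) ^+ 2|
    <= `|f'' d - f'' x| * (t - x) ^+ 2].
Proof.
move=> df df' xab tab.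
pose p s := f' x * s + f'' x / 2 * (s - x) ^+ 2.
pose g s := f s - p s.
have cp : continuous p.
  move=> s.
  apply: cvgD; first by apply: cvgM; [exact: cvg_cst|exact: cvg_id].
  apply: cvgM; first exact: cvg_cst.
  by apply: cvgM; (apply: cvgB; [exact: cvg_id|exact: cvg_cst]).
have cg : {within `[a, b], continuous g}.
  move=> s; apply: cvgB; first exact: (has_derivative_on_continuous df).
  exact: (continuous_subspaceT cp).
have dg s : s \in `]a, b[ -> is_derive s 1 g (f' s - (f' x + f'' x * (s - x))).
  move=> sab; have dfs := has_derivative_on_is_derive df sab.
  have dps : is_derive s 1 p (f' x + f'' x * (s - x)).
    by apply: is_derive_eq; rewrite /GRing.scale /=; field.
  exact: (@is_deriveB _ _ _ f p s 1 _ _ dfs dps).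
have [c [cab cx Ec]] := mvt_between cg dg xab tab.
have [d [dab dc Ed]] := mvt_between (has_derivative_on_continuous df')
  (fun s => has_derivative_on_is_derive df' (x := s)) xab cab.
exists d; split => //; first exact: le_trans dc cx.
have -> : f t - f x - f' x * (t - x) - f'' x / 2 * (t - x) ^+ 2 =
   (f'' d - f'' x) * ((c - x) * (t - x)).
  have -> : (f'' d - f'' x) * ((c - x) * (t - x)) =
   (f'' d * (c - x) - f'' x * (c - x)) * (t - x) by ring.
  rewrite -Ed (_ : f' c - f' x - _ = f' c - (f' x + f'' x * (c - x))); last by ring.
  by rewrite -Ec /g /p subrr; ring.
rewrite normrM ler_wpM2l // normrM -[X in _ <= X]real_normK ?num_real // expr2.
by rewrite ler_wpM2r.
Qed.

Lemma taylor2_bound {R : realType} (a b : R) (f f' f'' : R -> R) (e : R) :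
  a <= b ->
  has_derivative_on `[a, b] f f' -> has_derivative_on `[a, b] f' f'' ->
  {within `[a, b], continuous f''} -> 0 < e ->
  exists2 C : R, 0 < C & forall x t, x \in `[a, b] -> t \in `[a, b] ->
   `|f t - f x - f' x * (t - x) - f'' x / 2 * (t - x) ^+ 2|
    <= e * (t - x) ^+ 2 + C * (t - x) ^+ 4.
Proof.
move=> ab df df' cf e0; have [C C0 hC] := quadratic_modulus ab cf e0.
exists C => // x t abx abt.
have [d [abd dx h]] := taylor2_remainder df df' abx abt.
rewrite (le_trans h) //.
have -> : e * (t - x) ^+ 2 + C * (t - x) ^+ 4 = (e + C * (t - x) ^+ 2) * (t - x) ^+ 2.
  by ring.
rewrite ler_wpM2r ?sqr_ge0 // (le_trans (hC _ _ abd abx)) // lerD2l ler_pM2l //.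
by rewrite -[X in X <= _]real_normK ?num_real // -[X in _ <= X]real_normK ?num_real // ler_sqr ?nnegrE.
Qed.

(** * Integrals over [0, 1] and the Beta function *)

(** [powR] sends negative numbers to 1, so [t `^ c] is discontinuous at 0 from
    the left; the absolute value repairs this and agrees with it on [0, 1]. *)
Lemma continuous_norm_powR {R : realType} (c : R) :
  0 <= c -> continuous (fun t : R => `|t| `^ c).
Proof.
rewrite le_eqVlt => /predU1P[<-|c0] t.
  by rewrite (_ : (fun t => _) = cst 1); [exact: cvg_cst|apply/funext => s; rewrite powRr0].
(* At 0, [|s| < e^(1/c)] gives [|s|^c < e]. *)
have [->|t0] := eqVneq t 0.
  rewrite /continuous_at normr0 powR0 ?gt_eqF //.
  apply/cvgrPdist_lt => e e0; near=> s.
  rewrite sub0r normrN ger0_norm ?powR_ge0 //.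
  have -> : e = (e `^ c^-1) `^ c by rewrite -powRrM mulVf ?gt_eqF // powRr1 ?ltW.
  apply: gt0_ltr_powR; rewrite ?nnegrE ?powR_ge0 //.
  near: s; exact: (@nbhs0_lt R R (e `^ c^-1) (powR_gt0 _ e0)).
apply: (@continuous_comp _ _ _ (fun t : R => `|t|) (fun s => s `^ c)).
  exact: norm_continuous.
apply: differentiable_continuous; apply/derivable1_diffP.
by apply: derivable_powR; rewrite in_itv /= andbT normr_gt0.
Unshelve. all: by end_near. Qed.

Definition int01 {R : realType} (f : R -> R) : R :=
  (\int[@lebesgue_measure R]_(t in `[0%R, 1%R]) f t)%R.

Lemma integrable_continuous01 {R : realType} (g : R -> R) :
  {within `[0, 1], continuous g} ->
  (@lebesgue_measure R).-integrable `[0, 1] (EFin \o g).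
Proof. by apply: continuous_compact_integrable; exact: segment_compact. Qed.

Lemma within_continuous_linear {R : realType} (A : set R) (c d : R) (f g : R -> R) :
  {within A, continuous f} -> {within A, continuous g} ->
  {within A, continuous (fun t => c * f t + d * g t)}.
Proof.
move=> cf cg t; apply: cvgD.
  by apply: cvgM; [exact: cvg_cst|exact: cf].
by apply: cvgM; [exact: cvg_cst|exact: cg].
Qed.

Lemma eq_int01 {R : realType} (f g : R -> R) :
  (forall t, 0 <= t <= 1 -> f t = g t) -> int01 f = int01 g.
Proof.
move=> fg; apply: eq_Rintegral => t; rewrite inE /= in_itv /=; exact: fg.
Qed.

Lemma int01Z {R : realType} (c : R) (f : R -> R) :
  {within `[0, 1], continuous f} -> int01 (fun t => c * f t) = c * int01 f.
Proof.
move=> cf; apply: RintegralZl; [exact: measurable_itv|exact: integrable_continuous01].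
Qed.

Lemma int01_linear {R : realType} (c d : R) (f g : R -> R) :
  {within `[0, 1], continuous f} -> {within `[0, 1], continuous g} ->
  int01 (fun t => c * f t + d * g t) = c * int01 f + d * int01 g.
Proof.
move=> cf cg; rewrite -!int01Z //.
have Z (e : R) (h : R -> R) : {within `[0, 1], continuous h} ->
    (@lebesgue_measure R).-integrable `[0, 1] (EFin \o (fun t => e * h t)).
  move=> ch; apply: integrable_continuous01 => t.
  by apply: cvgM; [exact: cvg_cst|exact: ch].
by apply: RintegralD; [exact: measurable_itv|exact: Z|exact: Z].
Qed.

Lemma ler_int01 {R : realType} (f g : R -> R) :
  {within `[0, 1], continuous f} -> {within `[0, 1], continuous g} ->
  (forall t, 0 <= t <= 1 -> f t <= g t) -> int01 f <= int01 g.
Proof.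
move=> cf cg fg.
apply: le_Rintegral; first exact: measurable_itv.
- exact: integrable_continuous01.
- exact: integrable_continuous01.
- by move=> t /=; rewrite in_itv /=; exact: fg.
Qed.

Definition beta_weight {R : realType} (a b t : R) : R := t `^ a * (1 - t) `^ b.

Lemma within_continuous_beta_weight {R : realType} (a b : R) :
  0 <= a -> 0 <= b -> {within `[0, 1], continuous (@beta_weight R a b)}.
Proof.
move=> a0 b0.
pose w (t : R) := `|t| `^ a * `|1 - t| `^ b.
have cw : continuous w.
  move=> t; apply: cvgM; first exact: continuous_norm_powR.
  apply: (@continuous_comp _ _ _ (fun t : R => 1 - t) (fun s => `|s| `^ b)).
    by apply: cvgB; [exact: cvg_cst|exact: cvg_id].
  exact: continuous_norm_powR.
apply: (@subspace_eq_continuous _ _ _ w); last exact: continuous_subspaceT.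
move=> t; rewrite inE /= in_itv /= => /andP[t0 t1].
by rewrite /w /beta_weight !ger0_norm // subr_ge0.
Qed.

Definition beta_integral {R : realType} (a b : R) : R := int01 (beta_weight a b).

Lemma beta_weightSl {R : realType} (a b t : R) : 0 <= t -> 0 <= a ->
  beta_weight (a + 1) b t = t * beta_weight a b t.
Proof.
move=> t0 a0; rewrite /beta_weight mulrA -[in RHS](addrK 1 a) mulr_powRB1 //.
by rewrite ltr_wpDl.
Qed.

(** The weight dominates a polynomial one, [t^m (1 - t)^m] with a natural number
    [m] above both exponents, whose integral is positive. *)
Lemma beta_integral_gt0 {R : realType} (a b : R) : 0 <= a -> 0 <= b -> 0 < beta_integral a b.
Proof.
move=> a0 b0.
have [m am bm] : exists2 m : nat, a <= m%:R & b <= m%:R.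
  exists (maxn (Num.bound a) (Num.bound b)).
    by rewrite (le_trans (ltW (archi_boundP a0))) // ler_nat leq_maxl.
  by rewrite (le_trans (ltW (archi_boundP b0))) // ler_nat leq_maxr.
have low (t c : R) : 0 <= t <= 1 -> 0 <= c -> c <= m%:R -> t ^+ m <= t `^ c.
  move=> /andP[t0 t1] c0 cm; rewrite -powR_mulrn //.
  move: t0; rewrite le_eqVlt => /predU1P[<-|t0]; last by apply: ger_powR; rewrite ?t0.
  have [c00|c00] := eqVneq c 0; last by rewrite (powR0 c00) powR0 // gt_eqF // (lt_le_trans _ cm) // lt_neqAle eq_sym c00.
  by rewrite c00 powRr0; case: (m) => [|j]; rewrite ?powRr0 // powR0.
apply: (@lt_le_trans _ _ (int01 (XMonemX m m))).
  have := @beta_fun_gt0 R m.+1 m.+1; rewrite /beta_fun /=.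
  by rewrite -Rintegral_mkcond.
apply: ler_int01; first exact: within_continuous_XMonemX.
  exact: within_continuous_beta_weight.
move=> t t01; rewrite /XMonemX /beta_weight ler_pM //.
- by rewrite exprn_ge0 //; case/andP: t01.
- by rewrite exprn_ge0 // subr_ge0; case/andP: t01.
- exact: low.
- by apply: low => //; case/andP: t01 => t0 t1; rewrite subr_ge0 t1 lerBlDr lerDl.
Qed.

(** The derivative of [t^(a+1) (1-t)^(b+1)] is
    [(a+1) t^a (1-t)^b - (a+b+2) t^(a+1) (1-t)^b], and the function vanishes at
    both ends. *)
Lemma beta_integral_rec {R : realType} (a b : R) : 0 <= a -> 0 <= b ->
  (a + b + 2) * beta_integral (a + 1) b = (a + 1) * beta_integral a b.
Proof.
move=> a0 b0.
have a1 : 0 <= a + 1 by rewrite addr_ge0.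
have b1 : 0 <= b + 1 by rewrite addr_ge0.
pose F := @beta_weight R (a + 1) (b + 1).
pose dF t := (a + 1) * beta_weight a b t - (a + b + 2) * beta_weight (a + 1) b t.
have cF : {within `[0, 1], continuous F} := within_continuous_beta_weight a1 b1.
have cdF : {within `[0, 1], continuous dF}.
  move=> t; apply: cvgB; (apply: cvgM; first exact: cvg_cst).
    exact: within_continuous_beta_weight.
  exact: within_continuous_beta_weight.
have dFE (t : R) : t \in `]0, 1[ -> is_derive t 1 F (dF t).
  rewrite in_itv /= => /andP[t0 t1].
  have t1' : 0 < 1 - t by rewrite subr_gt0.
  have d1 : is_derive t 1 (fun s : R => s `^ (a + 1)) ((a + 1) * t `^ a).
    by have := is_derive1_powR (a + 1) t0; rewrite addrK.
  have d2 : is_derive t 1 (fun s : R => (1 - s) `^ (b + 1)) (- ((b + 1) * (1 - t) `^ b)).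
    have h := is_derive1_powR (b + 1) t1'; rewrite addrK in h.
    have h' : is_derive t 1 (fun s : R => 1 - s) (-1).
      by apply: is_derive_eq; ring.
    have := @is_derive1_comp R (fun s => s `^ (b + 1)) (fun s => 1 - s) t _ _ h h'.
    by rewrite /comp mulrN1.
  have D := @is_deriveM _ _ _ _ t 1 _ _ d1 d2.
  apply: (@is_derive_eq _ _ _ F t 1 _ _ D); rewrite /GRing.scale /=.
  rewrite /dF beta_weightSl ?(ltW t0) // /beta_weight.
  rewrite -(mulr_powRB1 (p := a + 1)) ?(ltW t0) ?ltr_wpDl // addrK.
  rewrite -(mulr_powRB1 (p := b + 1)) ?(ltW t1') ?ltr_wpDl // addrK.
  ring.
have E0 : F 0 = 0 by rewrite /F /beta_weight powR0 ?mul0r // gt_eqF // ltr_wpDl.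
have E1 : F 1 = 0 by rewrite /F /beta_weight subrr powR0 ?mulr0 // gt_eqF // ltr_wpDl.
have [_ F0 F1] := (continuous_within_itvP F ltr01).1 cF.
have H := @continuous_FTC2 R dF F 0 1 ltr01 cdF.
have {H} : int01 dF = 0.
  rewrite /int01 /Rintegral H.
  - by rewrite -EFinB /= E0 E1 subrr.
  - by split => // t t01; have [] := dFE t t01.
  - by move=> t t01; rewrite derive1E; have [_ ->] := dFE t t01.
have := int01_linear (a + 1) (- (a + b + 2)) (within_continuous_beta_weight a0 b0)
  (within_continuous_beta_weight a1 b0).
rewrite (@eq_int01 _ _ dF) => [->|t _]; last by rewrite mulNr.
by rewrite /beta_integral; lra.
Qed.

(** * Averages against the Beta densities *)

Lemma fourth_power_sum {R : realFieldType} (u s : R) :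
  (u + s) ^+ 4 <= 8 * u ^+ 4 + 8 * s ^+ 4.
Proof.
have h : (u + s) ^+ 2 <= 2 * (u ^+ 2 + s ^+ 2) by have := sqr_ge0 (u - s); lra.
have : ((u + s) ^+ 2) ^+ 2 <= (2 * (u ^+ 2 + s ^+ 2)) ^+ 2.
  by rewrite ler_sqr ?nnegrE ?sqr_ge0 // mulr_ge0 // addr_ge0 // sqr_ge0.
by have := sqr_ge0 (u ^+ 2 - s ^+ 2); lra.
Qed.

Definition beta_avg {R : realType} (rho : R) (n k : nat) (f : R -> R) : R :=
  (\int[@lebesgue_measure R]_(t in `[0%R, 1%R]) (mu_rho rho n k t * f t))%R.

Lemma beta_avgE {R : realType} (rho : R) (n k : nat) (f : R -> R) :
  let a := k%:R * rho in let b := (n - k)%:R * rho in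
  0 <= rho -> {within `[0, 1], continuous f} ->
  beta_avg rho n k f = int01 (fun t => beta_weight a b t * f t) / beta_integral a b.
Proof.
move=> a b rho0 cf.
have a0 : 0 <= a by rewrite mulr_ge0.
have b0 : 0 <= b by rewrite mulr_ge0.
have BE : Beta (a + 1) (b + 1) = beta_integral a b by rewrite /Beta !addrK.
rewrite [RHS]mulrC -int01Z; last first.
  by move=> t; apply: cvgM; [exact: within_continuous_beta_weight|exact: cf].
by apply: eq_int01 => t _; rewrite /mu_rho -/a -/b BE -[X in X / _ * _]/(beta_weight a b t); ring.
Qed.

Section BetaAverage.
Context {R : realType} (rho : R) (n k : nat).
Context (rho0 : 0 < rho).
Local Notation E := (beta_avg rho n k).
Let a := k%:R * rho.
Let b := (n - k)%:R * rho.

Let a0 : 0 <= a. Proof. by rewrite mulr_ge0 // ltW. Qed.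
Let rho_ge0 : 0 <= rho. Proof. exact: ltW. Qed.
Let b0 : 0 <= b. Proof. by rewrite mulr_ge0 // ltW. Qed.

Let within_continuous_weighted (f : R -> R) :
  {within `[0, 1], continuous f} ->
  {within `[0, 1], continuous (fun t => beta_weight a b t * f t)}.
Proof.
by move=> cf t; apply: cvgM; [exact: within_continuous_beta_weight|exact: cf].
Qed.

Lemma eq_beta_avg (f g : R -> R) :
  (forall t, 0 <= t <= 1 -> f t = g t) -> E f = E g.
Proof. by move=> fg; apply: eq_int01 => t t01; rewrite fg. Qed.

Lemma beta_avg_linear (c d : R) (f g : R -> R) :
  {within `[0, 1], continuous f} -> {within `[0, 1], continuous g} ->
  E (fun t => c * f t + d * g t) = c * E f + d * E g.
Proof.
move=> cf cg; rewrite !beta_avgE //; last exact: within_continuous_linear.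
rewrite !mulrA -mulrDl -int01_linear; [|exact: within_continuous_weighted..].
by congr (_ / _); apply: eq_int01 => t _; ring.
Qed.

Lemma ler_beta_avg (f g : R -> R) :
  {within `[0, 1], continuous f} -> {within `[0, 1], continuous g} ->
  (forall t, 0 <= t <= 1 -> f t <= g t) -> E f <= E g.
Proof.
move=> cf cg fg; rewrite !beta_avgE // ler_pM2r ?invr_gt0 ?beta_integral_gt0 //.
apply: ler_int01; [exact: within_continuous_weighted..|].
by move=> t t01; rewrite ler_wpM2l ?fg // mulr_ge0 // powR_ge0.
Qed.

Lemma continuous_monomial (j : nat) : {within `[0, 1], continuous (fun t : R => t ^+ j)}.
Proof. by apply: continuous_subspaceT => t; exact: exprn_continuous. Qed.

Lemma beta_avg_monomialE (j : nat) :
  E (fun t => t ^+ j) = beta_integral (a + j%:R) b / beta_integral a b.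
Proof.
rewrite beta_avgE //; last exact: continuous_monomial.
congr (_ / _); apply: eq_int01 => t /andP[t0 _].
elim: j => [|j IH]; first by rewrite addr0 mulr1.
by rewrite exprS mulrCA IH -natr1 addrA beta_weightSl // addr_ge0.
Qed.

Lemma beta_avg_monomialS (j : nat) : (k <= n)%N ->
  (n%:R * rho + j%:R + 2) * E (fun t => t ^+ j.+1) =
  (k%:R * rho + j%:R + 1) * E (fun t => t ^+ j).
Proof.
move=> kn; rewrite !beta_avg_monomialE.
have abn : a + b = n%:R * rho by rewrite /a /b natrB //; ring.
have aj0 : 0 <= a + j%:R by rewrite addr_ge0.
have key : (n%:R * rho + j%:R + 2) * beta_integral (a + j.+1%:R) b
    = (a + j%:R + 1) * beta_integral (a + j%:R) b.
  have -> : a + j.+1%:R = a + j%:R + 1 by rewrite -addrA natr1.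
  rewrite -beta_integral_rec //; congr (_ * _); rewrite -abn; ring.
by rewrite !mulrA key.
Qed.

Lemma beta_avg_monomial0 : E (fun t => t ^+ 0) = 1.
Proof. by rewrite beta_avg_monomialE addr0 divff // gt_eqF // beta_integral_gt0. Qed.

(** All the moments below are evaluated on polynomials of degree at most four;
    a fixed shape lets linearity be used once and for all. *)
Definition quartic (c0 c1 c2 c3 c4 t : R) : R :=
  c0 + c1 * t + c2 * t ^+ 2 + c3 * t ^+ 3 + c4 * t ^+ 4.

Let quarticE (c0 c1 c2 c3 c4 : R) : quartic c0 c1 c2 c3 c4 = fun t =>
  1 * (1 * (1 * (c0 * t ^+ 0 + c1 * t ^+ 1) + c2 * t ^+ 2) + c3 * t ^+ 3)
  + c4 * t ^+ 4.
Proof. by apply/funext => t; rewrite /quartic; ring. Qed.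

Lemma continuous_quartic (c0 c1 c2 c3 c4 : R) :
  {within `[0, 1], continuous (quartic c0 c1 c2 c3 c4)}.
Proof.
have M := continuous_monomial.
rewrite quarticE; do 3 ?[apply: within_continuous_linear => //].
exact: within_continuous_linear.
Qed.

Lemma beta_avg_quartic (c0 c1 c2 c3 c4 : R) :
  let m j := E (fun t => t ^+ j) in
  E (quartic c0 c1 c2 c3 c4) = c0 + c1 * m 1 + c2 * m 2 + c3 * m 3 + c4 * m 4.
Proof.
move=> m; have M := continuous_monomial.
have C (d : R) (j : nat) (f : R -> R) : {within `[0, 1], continuous f} ->
   {within `[0, 1], continuous (fun t : R => 1 * f t + d * t ^+ j)}.
  by move=> cf; apply: within_continuous_linear.
have C1 : {within `[0, 1], continuous (fun t : R => c0 * t ^+ 0 + c1 * t ^+ 1)}.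
  exact: within_continuous_linear.
have C2 := C c2 2 _ C1; have C3 := C c3 3 _ C2.
by rewrite quarticE !beta_avg_linear // !mul1r beta_avg_monomial0 mulr1.
Qed.

End BetaAverage.

(** The moments about [x] are written in terms of the deviation [k - n x] of
    the index, so that averaging over the index only involves the moments of
    that deviation. *)
Lemma beta_avg_central1 {R : realType} (rho : R) (n k : nat) (x : R) :
  0 < rho -> (k <= n)%N ->
  beta_avg rho n k (fun t => t - x) =
  (rho * (k%:R - n%:R * x) + 1 - 2 * x) / (n%:R * rho + 2).
Proof.
move=> rho0 kn.
have N0 : 0 <= n%:R * rho by rewrite mulr_ge0 // ltW.
rewrite (@eq_beta_avg _ _ _ _ _ (quartic (- x) 1 0 0 0)); last first.
  by move=> t _; rewrite /quartic; ring.
rewrite beta_avg_quartic //.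
have := beta_avg_monomialS rho0 0 kn; rewrite beta_avg_monomial0 //.
set m1 := beta_avg _ _ _ (fun t => t ^+ 1) => H1.
have -> : m1 = (k%:R * rho + 1) / (n%:R * rho + 2).
  by apply: (mulfI (x := n%:R * rho + 2)); [lra|rewrite mulrCA divff; lra].
by field; lra.
Qed.

Lemma beta_avg_central2 {R : realType} (rho : R) (n k : nat) (x : R) :
  let v := k%:R - n%:R * x in let X := x * (1 - x) in
  0 < rho -> (k <= n)%N ->
  beta_avg rho n k (fun t => (t - x) ^+ 2) =
  (rho ^+ 2 * v ^+ 2 + 3 * rho * (1 - 2 * x) * v + n%:R * rho * X + 2 - 6 * X)
  / ((n%:R * rho + 2) * (n%:R * rho + 3)).
Proof.
move=> v X rho0 kn.
have N0 : 0 <= n%:R * rho by rewrite mulr_ge0 // ltW.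
rewrite (@eq_beta_avg _ _ _ _ _ (quartic (x ^+ 2) (- 2 * x) 1 0 0)); last first.
  by move=> t _; rewrite /quartic; ring.
rewrite beta_avg_quartic //.
have := beta_avg_monomialS rho0 0 kn; rewrite beta_avg_monomial0 //.
have := beta_avg_monomialS rho0 1 kn.
set m1 := beta_avg _ _ _ (fun t => t ^+ 1).
set m2 := beta_avg _ _ _ (fun t => t ^+ 2) => H2 H1.
have E1 : m1 = (k%:R * rho + 1) / (n%:R * rho + 2).
  by apply: (mulfI (x := n%:R * rho + 2)); [lra|rewrite mulrCA divff; lra].
have E2 : m2 = (k%:R * rho + 2) * m1 / (n%:R * rho + 3).
  by apply: (mulfI (x := n%:R * rho + 3)); [lra|rewrite mulrCA divff; lra].
by rewrite E2 E1 /v /X; field; lra.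
Qed.

(** Write [y = k / n] and [N = n rho].  Integration by parts against the Beta
    density gives, for a polynomial [g],
      N E ((t - y) g) = E ((t (1 - t) g)').
    With [g = t - y] the right-hand side is bounded by 2, and with
    [g = (t - y)^3] it is at most twice the second moment, so each step gains a
    factor [1 / N].  Both identities are linear combinations of the moment
    recursion, with the coefficients of [g] as multipliers. *)
Lemma beta_avg_fourth_mean {R : realType} (rho : R) (n k : nat) :
  0 < rho -> (0 < n)%N -> (k <= n)%N ->
  beta_avg rho n k (fun t => (t - k%:R / n%:R) ^+ 4) <= 4 / (n%:R * rho) ^+ 2.
Proof.
move=> rho0 n0 kn.
have nR : 0 < n%:R :> R by rewrite ltr0n.
set y := k%:R / n%:R.
have y01 : 0 <= y <= 1 by rewrite /y divr_ge0 //= ler_pdivrMr // mul1r ler_nat.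
have kE : k%:R * rho = n%:R * rho * y by rewrite /y; field; rewrite gt_eqF.
set N := n%:R * rho in kE *.
have N0 : 0 < N by rewrite mulr_gt0.
have m0 := beta_avg_monomial0 n k rho0.
have := (beta_avg_monomialS rho0 0 kn, beta_avg_monomialS rho0 1 kn,
  beta_avg_monomialS rho0 2 kn, beta_avg_monomialS rho0 3 kn).
rewrite kE -/N m0.
set E := beta_avg rho n k.
set m1 := E (fun t => t ^+ 1); set m2 := E (fun t => t ^+ 2).
set m3 := E (fun t => t ^+ 3); set m4 := E (fun t => t ^+ 4).
move=> [[[H1 H2] H3] H4].
have EQ c0 c1 c2 c3 c4 : E (quartic c0 c1 c2 c3 c4) =
  c0 + c1 * m1 + c2 * m2 + c3 * m3 + c4 * m4 by rewrite /E beta_avg_quartic.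
pose sq := quartic (y ^+ 2) (- 2 * y) 1 0 0.
pose q4 := quartic (y ^+ 4) (- 4 * y ^+ 3) (6 * y ^+ 2) (- 4 * y) 1.
(* An affine function of [y] is nonnegative on [0, 1] when it is so at both ends. *)
have interp (a b : R) : 0 <= a -> 0 <= a + b -> 0 <= a + y * b.
  by move=> ha hab; case/andP: y01 => y0 y1; nra.
have le2 : N * E sq <= 2.
  (* The right-hand side is the expansion of [(1 - 2 t) (t - y) + t (1 - t)]. *)
  have -> : N * E sq = E (quartic (- y) (2 + 2 * y) (- 3) 0 0).
    by rewrite !EQ; have := congr1 (fun z => y * z) H1; lra.
  rewrite [X in _ <= X](_ : 2 = E (quartic 2 0 0 0 0)); last by rewrite EQ; ring.
  apply: ler_beta_avg => //; [exact: continuous_quartic..|].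
  move=> t _; rewrite /quartic.
  have := interp (2 - 2 * t + 3 * t ^+ 2) (1 - 2 * t).
  have := sqr_ge0 (3 * t - 1); have := sqr_ge0 (3 * t - 2) => h1 h2.
  by move=> /(_ ltac:(lra) ltac:(lra)); lra.
have le4 : N * E q4 <= 2 * E sq.
  (* The right-hand side is the expansion of
     [((1 - 2 t) (t - y) + 3 t (1 - t)) (t - y)^2]. *)
  have -> : N * E q4 = E (quartic (- y ^+ 3) (6 * y ^+ 2 + 2 * y ^+ 3)
     (- 9 * y - 9 * y ^+ 2) (4 + 12 * y) (- 5)).
    rewrite !EQ; have := congr1 (fun z => y ^+ 3 * z) H1.
    have := congr1 (fun z => y ^+ 2 * z) H2; have := congr1 (fun z => y * z) H3.
    by lra.
  have -> : 2 * E sq = E (quartic (2 * y ^+ 2) (- 4 * y) 2 0 0) by rewrite !EQ; ring.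
  apply: ler_beta_avg => //; [exact: continuous_quartic..|].
  move=> t _.
  have -> : quartic (2 * y ^+ 2) (- 4 * y) 2 0 0 t = 2 * (t - y) ^+ 2.
    by rewrite /quartic; ring.
  have -> : quartic (- y ^+ 3) (6 * y ^+ 2 + 2 * y ^+ 3)
     (- 9 * y - 9 * y ^+ 2) (4 + 12 * y) (- 5) t
    = ((1 - 2 * t) * (t - y) + 3 * (t * (1 - t))) * (t - y) ^+ 2.
    by rewrite /quartic; ring.
  rewrite ler_wpM2r ?sqr_ge0 //.
  have := interp (2 - 4 * t + 5 * t ^+ 2) (1 - 2 * t).
  have := sqr_ge0 (5 * t - 2); have := sqr_ge0 (5 * t - 3) => h1 h2.
  by move=> /(_ ltac:(lra) ltac:(lra)); lra.
rewrite (_ : (fun t => _) = q4); last by apply/funext => t; rewrite /q4 /quartic; ring.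
rewrite -/E ler_pdivlMr ?exprn_gt0 // expr2 mulrA; nra.
Qed.

Lemma beta_avg_central4 {R : realType} (rho : R) (n k : nat) (x : R) :
  0 < rho -> (0 < n)%N -> (k <= n)%N ->
  beta_avg rho n k (fun t => (t - x) ^+ 4) <=
  32 / (n%:R * rho) ^+ 2 + 8 / n%:R ^+ 4 * (k%:R - n%:R * x) ^+ 4.
Proof.
move=> rho0 n0 kn; set y := k%:R / n%:R : R.
have nR : 0 < n%:R :> R by rewrite ltr0n.
pose q (z : R) := quartic (z ^+ 4) (- 4 * z ^+ 3) (6 * z ^+ 2) (- 4 * z) 1.
have qE (z : R) : (fun t => (t - z) ^+ 4) = q z.
  by apply/funext => t; rewrite /q /quartic; ring.
have cq (z : R) : {within `[0, 1], continuous (fun t : R => (t - z) ^+ 4)}.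
  by rewrite qE; exact: continuous_quartic.
have c1 : {within `[0, 1], continuous (fun _ : R => 1 : R)} by move=> t; exact: cvg_cst.
have -> : 8 / n%:R ^+ 4 * (k%:R - n%:R * x) ^+ 4 = 8 * (y - x) ^+ 4.
  by rewrite /y; field; rewrite gt_eqF.
have -> : 32 / (n%:R * rho) ^+ 2 = 8 * (4 / (n%:R * rho) ^+ 2).
  by field; rewrite !gt_eqF.
apply: (@le_trans _ _ (beta_avg rho n k
    (fun t => 8 * (t - y) ^+ 4 + 8 * (y - x) ^+ 4 * 1))); last first.
  rewrite beta_avg_linear // lerD // ?ler_pM2l //.
    exact: beta_avg_fourth_mean.
  rewrite (@eq_beta_avg _ _ _ _ _ (fun t => t ^+ 0)) => [|t _]; last by rewrite expr0.
  by rewrite beta_avg_monomial0 // mulr1.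
apply: ler_beta_avg => //; first exact: within_continuous_linear.
move=> t _; rewrite mulr1.
set u := t - y; set s := y - x; rewrite (_ : t - x = u + s) /u /s; last by ring.
rewrite -/u -/s.
exact: fourth_power_sum.
Qed.

(** Averaging is positive and linear, so a polynomial majorant and minorant of
    [f] pass to the averages. *)
Lemma beta_avg_taylor {R : realType} (rho : R) (n k : nat) (f : R -> R)
    (x c p q e C : R) :
  let E := beta_avg rho n k in
  0 < rho -> {within `[0, 1], continuous f} ->
  (forall t, 0 <= t <= 1 ->
     `|f t - c - p * (t - x) - q * (t - x) ^+ 2|
     <= e * (t - x) ^+ 2 + C * (t - x) ^+ 4) ->
  `|E f - (c + p * E (fun t => t - x) + q * E (fun t => (t - x) ^+ 2))|
  <= e * E (fun t => (t - x) ^+ 2) + C * E (fun t => (t - x) ^+ 4).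
Proof.
move=> E rho0 cf fle.
have cm (j : nat) : {within `[0, 1], continuous (fun t : R => (t - x) ^+ j)}.
  apply: continuous_subspaceT => t.
  apply: (@continuous_comp _ _ _ (fun t : R => t - x) (fun s => s ^+ j)).
    by apply: cvgB; [exact: cvg_id|exact: cvg_cst].
  exact: exprn_continuous.
pose P s w (t : R) := 1 * (1 * (c * (t - x) ^+ 0 + p * (t - x) ^+ 1) + s * (t - x) ^+ 2)
   + w * (t - x) ^+ 4.
have c1 : {within `[0, 1], continuous (fun t : R => c * (t - x) ^+ 0 + p * (t - x) ^+ 1)}.
  exact: within_continuous_linear.
have c2 (s : R) : {within `[0, 1], continuous (fun t : R =>
    1 * (c * (t - x) ^+ 0 + p * (t - x) ^+ 1) + s * (t - x) ^+ 2)}.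
  exact: within_continuous_linear.
have cP (s w : R) : {within `[0, 1], continuous (P s w)}.
  exact: within_continuous_linear.
have EP s w : E (P s w) = c + p * E (fun t => t - x) + s * E (fun t => (t - x) ^+ 2)
     + w * E (fun t => (t - x) ^+ 4).
  rewrite /P /E !beta_avg_linear // !mul1r.
  rewrite (@eq_beta_avg _ _ _ _ (fun t => (t - x) ^+ 0) (fun t => t ^+ 0)) //.
  by rewrite beta_avg_monomial0 // mulr1.
have up : E f <= E (P (q + e) C).
  apply: ler_beta_avg => // t /fle; rewrite ler_norml /P => /andP[_]; lra.
have dn : E (P (q - e) (- C)) <= E f.
  apply: ler_beta_avg => // t /fle; rewrite ler_norml /P => /andP[+ _]; lra.
rewrite !EP in up dn.
rewrite ler_norml; apply/andP; split; lra.
Qed.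

(** * The distribution of the index *)

Definition binomial_mean {R : realType} (m : nat) (x : R) (g : nat -> R) : R :=
  \sum_(k < m.+1) 'C(m, k)%:R * (x ^+ k * (1 - x) ^+ (m - k)) * g k.

(** Pascal's rule: one more Bernoulli trial. *)
Lemma binomial_meanS {R : realType} (m : nat) (x : R) (g : nat -> R) :
  binomial_mean m.+1 x g = binomial_mean m x (fun k => (1 - x) * g k + x * g k.+1).
Proof.
rewrite /binomial_mean.
transitivity (\sum_(k < m.+1) 'C(m, k)%:R * (x ^+ k * (1 - x) ^+ (m.+1 - k)) * g k
   + \sum_(k < m.+1) 'C(m, k)%:R * (x ^+ k.+1 * (1 - x) ^+ (m - k)) * g k.+1).
  rewrite big_ord_recl /= [in RHS]big_ord_recl /= !bin0 -addrA; congr (_ + _).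
  rewrite [in RHS](_ : \sum_(i < m) _ =
      \sum_(k < m.+1) 'C(m, k.+1)%:R * (x ^+ k.+1 * (1 - x) ^+ (m - k)) * g k.+1).
    by rewrite -big_split; apply: eq_bigr => k _; rewrite /= /bump /= add1n binS subSS natrD; ring.
  by rewrite [RHS]big_ord_recr /= bin_small // mul0r mul0r addr0.
rewrite -big_split; apply: eq_bigr => k _ /=.
have km : (k <= m)%N by rewrite -ltnS.
by rewrite subSn // !(exprS _ k) !(exprS _ (m - k)); ring.
Qed.

Lemma eq_binomial_mean {R : realType} (m : nat) (x : R) (g h : nat -> R) :
  g =1 h -> binomial_mean m x g = binomial_mean m x h.
Proof. by move=> gh; apply: eq_bigr => k _; rewrite gh. Qed.

Lemma binomial_mean_ge0 {R : realType} (m : nat) (x : R) (g : nat -> R) :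
  0 <= x <= 1 -> (forall k, (k <= m)%N -> 0 <= g k) -> 0 <= binomial_mean m x g.
Proof.
move=> /andP[x0 x1] g0; apply: sumr_ge0 => k _.
by rewrite !mulr_ge0 ?exprn_ge0 ?subr_ge0 // g0 // -ltnS.
Qed.

Lemma binomial_mean_linear {R : realType} (m : nat) (x c d : R) (g h : nat -> R) :
  binomial_mean m x (fun k => c * g k + d * h k) = c * binomial_mean m x g + d * binomial_mean m x h.
Proof.
rewrite /binomial_mean !mulr_sumr -big_split; apply: eq_bigr => k _ /=; ring.
Qed.

Lemma ler_binomial_mean {R : realType} (m : nat) (x : R) (g h : nat -> R) :
  0 <= x <= 1 -> (forall k, (k <= m)%N -> g k <= h k) ->
  binomial_mean m x g <= binomial_mean m x h.
Proof.
move=> x01 gh; rewrite -subr_ge0 -[X in X - _]mul1r -mulN1r -binomial_mean_linear.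
by apply: binomial_mean_ge0 => // k km; rewrite mul1r mulN1r subr_ge0 gh.
Qed.

(** By induction on the number of trials: after one trial a quartic in the
    centred variable is again a quartic in it, so generalizing over all the
    coefficients closes the induction. *)
Lemma binomial_mean_quartic {R : realType} (m : nat) (x c0 c1 c2 c3 c4 : R) :
  let u k := k%:R - m%:R * x in
  let X := x * (1 - x) in
  binomial_mean m x (fun k => c0 + c1 * u k + c2 * u k ^+ 2 + c3 * u k ^+ 3 + c4 * u k ^+ 4)
  = c0 + c2 * (m%:R * X) + c3 * (m%:R * X * (1 - 2 * x))
    + c4 * (3 * m%:R ^+ 2 * X ^+ 2 + m%:R * X * (1 - 6 * X)).
Proof.
elim: m c0 c1 c2 c3 c4 => [|m IH] c0 c1 c2 c3 c4 u X.
  by rewrite /binomial_mean big_ord1 /u /= bin0; ring.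
rewrite binomial_meanS.
pose y := 1 - x.
(* The new coefficients come from expanding the quartic at [u - x] and at
   [u + (1 - x)]. *)
rewrite (@eq_binomial_mean _ _ _ _ (fun k => let u := k%:R - m%:R * x in
   ((1 - x) * (c0 + c1 * (- x) + c2 * x ^+ 2 - c3 * x ^+ 3 + c4 * x ^+ 4)
     + x * (c0 + c1 * y + c2 * y ^+ 2 + c3 * y ^+ 3 + c4 * y ^+ 4))
   + ((1 - x) * (c1 - 2 * c2 * x + 3 * c3 * x ^+ 2 - 4 * c4 * x ^+ 3)
     + x * (c1 + 2 * c2 * y + 3 * c3 * y ^+ 2 + 4 * c4 * y ^+ 3)) * u
   + ((1 - x) * (c2 - 3 * c3 * x + 6 * c4 * x ^+ 2)
     + x * (c2 + 3 * c3 * y + 6 * c4 * y ^+ 2)) * u ^+ 2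
   + ((1 - x) * (c3 - 4 * c4 * x) + x * (c3 + 4 * c4 * y)) * u ^+ 3
   + c4 * u ^+ 4)); last first.
  by move=> k; rewrite /u /y -!natr1; ring.
rewrite IH /X /y -natr1; ring.
Qed.

(** Mean of [g] after a jump from [k]: a step in {0, 1, 2} of law [d0, d1, d2]
    coming from the alpha-Bernstein basis, then one more unit step with
    weight [B]. *)
Definition jump_mean {R : realType} (alpha A B x : R) (g : nat -> R) (k : nat) : R :=
  let d0 := (1 - alpha) * (1 - x) + alpha * (1 - x) ^+ 2 in
  let d1 := 2 * alpha * x * (1 - x) in
  let d2 := (1 - alpha) * x + alpha * x ^+ 2 in
  A * (d0 * g k + d1 * g k.+1 + d2 * g k.+2)
  + B * (d0 * g k.+1 + d1 * g k.+2 + d2 * g k.+3).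

(** The first two terms of the basis are binomial laws with [r] trials shifted
    by 0 and 2 and weighted by [1 - x] and [x]; the third one is the binomial law
    with [r + 2] trials, that is, [r] trials followed by two more. *)
Lemma sum_bernstein_alpha {R : realType} (alpha : R) (r : nat) (x : R) (g : nat -> R) :
  \sum_(k < r.+3) bernstein_alpha alpha r.+2 k%:Z x * g k =
  binomial_mean r x (fun k =>
  let d0 := (1 - alpha) * (1 - x) + alpha * (1 - x) ^+ 2 in
  let d1 := 2 * alpha * x * (1 - x) in
  let d2 := (1 - alpha) * x + alpha * x ^+ 2 in
  d0 * g k + d1 * g k.+1 + d2 * g k.+2).
Proof.
pose T0 := binomial_mean r x g.
pose T2 := binomial_mean r x (fun k => g k.+2).
transitivity ((1 - alpha) * ((1 - x) * T0 + x * T2) + alpha * binomial_mean r.+2 x g).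
  pose h k := (1 - alpha) * ((1 - x) * ('C(r, k)%:R * (x ^+ k * (1 - x) ^+ (r - k)))) * g k.
  pose h' k := (1 - alpha) * (x * ('C(r, k)%:R * (x ^+ k * (1 - x) ^+ (r - k)))) * g k.+2.
  transitivity (\sum_(k < r.+3) h k + \sum_(k < r.+3) (if (k : nat) is j.+2 then h' j else 0)
     + \sum_(k < r.+3) alpha * ('C(r.+2, k)%:R * (x ^+ k * (1 - x) ^+ (r.+2 - k)) * g k)).
    rewrite -!big_split; apply: eq_bigr => k _ /=.
    rewrite ltnNge -ltnS ltn_ord /= !mulrDl; congr (_ + _ + _).
    - rewrite /h; have [kr|kr] := leqP k r; last by rewrite bin_small //; ring.
      have -> : (r.+2 - k - 1 = (r - k).+1)%N by rewrite subSn ?subn1 ?subSn // leqW.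
      by rewrite exprS; ring.
    - case: k => [[|[|j]] /= jr]; rewrite ?mul0r //.
      by rewrite /h' subn1 /= !subSS subn0 exprS; ring.
    - by ring.
  congr (_ + _); last by rewrite /binomial_mean mulr_sumr.
  rewrite mulrDr; congr (_ + _).
    rewrite 2!big_ord_recr /= /h 2?bin_small // !mul0r !mulr0 !mul0r !addr0.
    by rewrite /T0 /binomial_mean !mulr_sumr; apply: eq_bigr => k _; ring.
  rewrite 2!big_ord_recl /= !add0r /T2 /binomial_mean !mulr_sumr; apply: eq_bigr => k _.
  by rewrite /h' /=; ring.
rewrite 2!binomial_meanS -!binomial_mean_linear; apply: eq_bigr => k _ /=; congr (_ * _); ring.
Qed.

Definition index_mean {R : realType} (alpha A B : R) (r : nat) (x : R)
    (g : nat -> R) : R := binomial_mean r x (jump_mean alpha A B x g).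

Lemma jump_mean_ge0 {R : realType} (alpha A B x : R) (g : nat -> R) (k : nat) :
  0 <= alpha <= 1 -> 0 <= A -> 0 <= B -> 0 <= x <= 1 ->
  (forall j, (j <= k.+3)%N -> 0 <= g j) -> 0 <= jump_mean alpha A B x g k.
Proof.
move=> /andP[al0 al1] A0 B0 /andP[x0 x1] g0.
have y0 : 0 <= 1 - x by rewrite subr_ge0.
have b0 : 0 <= 1 - alpha by rewrite subr_ge0.
have [k0 k1 k2] : [/\ (k <= k.+3)%N, (k.+1 <= k.+3)%N & (k.+2 <= k.+3)%N].
  by split; do ?[exact: leqnn|apply: leqW].
by rewrite /jump_mean; do ?[done|apply: addr_ge0|apply: mulr_ge0|apply: exprn_ge0|apply: g0].
Qed.

Lemma jump_mean_linear {R : realType} (alpha A B x c d : R) (g h : nat -> R) (k : nat) :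
  jump_mean alpha A B x (fun j => c * g j + d * h j) k =
  c * jump_mean alpha A B x g k + d * jump_mean alpha A B x h k.
Proof. rewrite /jump_mean; ring. Qed.

Lemma eq_index_mean {R : realType} (alpha A B : R) (r : nat) (x : R) (g h : nat -> R) :
  g =1 h -> index_mean alpha A B r x g = index_mean alpha A B r x h.
Proof. by move=> /funext ->. Qed.

Lemma index_mean_linear {R : realType} (alpha A B : R) (r : nat) (x c d : R)
    (g h : nat -> R) :
  index_mean alpha A B r x (fun k => c * g k + d * h k) =
  c * index_mean alpha A B r x g + d * index_mean alpha A B r x h.
Proof.
rewrite /index_mean -binomial_mean_linear; apply: eq_binomial_mean => k; exact: jump_mean_linear.
Qed.

Lemma ler_index_mean {R : realType} (alpha A B : R) (r : nat) (x : R)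
    (g h : nat -> R) :
  0 <= alpha <= 1 -> 0 <= A -> 0 <= B -> 0 <= x <= 1 ->
  (forall k, (k <= r.+3)%N -> g k <= h k) ->
  index_mean alpha A B r x g <= index_mean alpha A B r x h.
Proof.
move=> al A0 B0 x01 gh; rewrite -subr_ge0.
rewrite -[X in X - _]mul1r -mulN1r -index_mean_linear.
apply: binomial_mean_ge0 => // k kr; apply: jump_mean_ge0 => // j jk.
by rewrite mul1r mulN1r subr_ge0 gh // (leq_trans jk).
Qed.

(** The deviation of the index is the sum of the binomial deviation and of the
    centred jump [i - 3 x]; the jump has mean [B - x] and variance
    [(4 - 2 alpha) x (1 - x) + B (1 - B)]. *)
Lemma index_mean_quadratic {R : realType} (alpha A B : R) (r : nat) (x c0 c1 c2 : R) :
  let v k := k%:R - r.+3%:R * x in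
  let X := x * (1 - x) in
  A + B = 1 ->
  index_mean alpha A B r x (fun k => c0 + c1 * v k + c2 * v k ^+ 2) =
  c0 + c1 * (B - x)
  + c2 * (r%:R * X + (4 - 2 * alpha) * X + B * (1 - B) + (B - x) ^+ 2).
Proof.
move=> v X AB; have -> : A = 1 - B by rewrite -AB addrK.
(* [q] at a shifted argument is expanded in powers of the binomial deviation
   [u]; [m h] is the mean of [h i] over the jump [i]. *)
pose q s := c0 + c1 * s + c2 * s ^+ 2.
pose q' s := c1 + 2 * c2 * s.
pose m h := jump_mean alpha (1 - B) B x h 0.
rewrite /index_mean (@eq_binomial_mean _ _ _ _ (fun k => let u := k%:R - r%:R * x in
  m (fun i => q (i%:R - 3 * x)) + m (fun i => q' (i%:R - 3 * x)) * u
  + c2 * u ^+ 2 + 0 * u ^+ 3 + 0 * u ^+ 4)); last first.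
  by move=> k; rewrite /m /q /q' /jump_mean /v -!natr1; ring.
rewrite binomial_mean_quartic /m /q /jump_mean /X; ring.
Qed.

(** The centred jump is at most 3 in absolute value, hence
    [(u + s)^4 <= 8 u^4 + 8 * 81] reduces the claim to the fourth binomial moment,
    at most [3 r^2 / 16 + r]; the constant 648 is absorbed because [r.+3 >= 3]. *)
Lemma index_mean_fourth {R : realType} (alpha A B : R) (r : nat) (x : R) :
  0 <= alpha <= 1 -> 0 <= A -> 0 <= B -> A + B = 1 -> 0 <= x <= 1 ->
  index_mean alpha A B r x (fun k => (k%:R - r.+3%:R * x) ^+ 4) <= 75 * r.+3%:R ^+ 2.
Proof.
move=> al A0 B0 AB x01; have /andP[x0 x1] := x01.
pose X := x * (1 - x).
have X0 : 0 <= X by rewrite mulr_ge0 // subr_ge0.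
have X4 : 4 * X <= 1 by rewrite /X; have := sqr_ge0 (1 - 2 * x); lra.
apply: (@le_trans _ _ (binomial_mean r x (fun k => let u := k%:R - r%:R * x in
    648 + 0 * u + 0 * u ^+ 2 + 0 * u ^+ 3 + 8 * u ^+ 4))); last first.
  rewrite binomial_mean_quartic -/X.
  have r0 : 0 <= r%:R :> R by [].
  have -> : r.+3%:R = r%:R + 3 :> R by rewrite -!natr1; ring.
  set s := r%:R in r0 *.
  have XX : 16 * X ^+ 2 <= 1 by nra.
  have : s ^+ 2 * (16 * X ^+ 2) <= s ^+ 2 by rewrite ler_piMr // exprn_ge0.
  have : s * (X * (1 - 6 * X)) <= s by rewrite ler_piMr //; nra.
  by have := sqr_ge0 s; nra.
apply: ler_binomial_mean => // k kr.
pose u := k%:R - r%:R * x.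
have key s : -3 <= s <= 3 -> (u + s) ^+ 4 <= 8 * u ^+ 4 + 648.
  move=> /andP[s1 s2].
  have ss : s ^+ 2 <= 9 by nra.
  have s4 : s ^+ 4 <= 81 by rewrite (exprM s 2 2); have := sqr_ge0 s; nra.
  have := fourth_power_sum u s; lra.
have := @jump_mean_ge0 R alpha A B x (fun j => 1 * (8 * u ^+ 4 + 648)
   + (- 1) * (u + (j%:R - 3 * x)) ^+ 4) 0 al A0 B0 x01.
rewrite jump_mean_linear => /(_ _) /=.
have -> : jump_mean alpha A B x (fun=> 8 * u ^+ 4 + 648) 0 = 8 * u ^+ 4 + 648.
  by have -> : A = 1 - B by [rewrite -AB addrK]; rewrite /jump_mean; ring.
have -> : jump_mean alpha A B x (fun j => (u + (j%:R - 3 * x)) ^+ 4) 0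
  = jump_mean alpha A B x (fun k => (k%:R - r.+3%:R * x) ^+ 4) k.
  by rewrite /jump_mean /= /u -!natr1; ring.
move=> H; rewrite -subr_ge0 (_ : _ - _ = 1 * (8 * u ^+ 4 + 648) + -1 *
  jump_mean alpha A B x (fun k => (k%:R - r.+3%:R * x) ^+ 4) k); last by rewrite /u; ring.
apply: H => j j3; rewrite mul1r mulN1r subr_ge0 key //.
have : j%:R <= 3 :> R by rewrite ler_nat.
have : 0 <= j%:R :> R by [].
lra.
Qed.

(** * Moments of the operator *)

(** The two families in the operator are the basis of degree [n - 1] and its
    shift by one; their weights [acoef a0 a1 x n] and [acoef a0 a1 (1 - x) n] are
    the law of the last unit step of the jump. *)
Lemma JM1_index_mean {R : realType} (alpha rho : R) (a0 a1 : R^nat) (r : nat)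
    (f : R -> R) (x : R) :
  JM1 alpha rho a0 a1 r.+3 f x =
  index_mean alpha (acoef a0 a1 x r.+3) (acoef a0 a1 (1 - x) r.+3) r x
    (fun k => beta_avg rho r.+3 k f).
Proof.
rewrite /JM1 /index_mean [r.+3.-1]/=.
set A := acoef _ _ x _; set B := acoef _ _ (1 - x) _.
set g := fun k : nat => beta_avg rho r.+3 k f.
transitivity (A * (\sum_(k < r.+3) bernstein_alpha alpha r.+2 k%:Z x * g k)
   + B * (\sum_(k < r.+3) bernstein_alpha alpha r.+2 k%:Z x * g k.+1)).
  rewrite (eq_bigr (fun k : 'I_r.+4 =>
    A * (bernstein_alpha alpha r.+2 k%:Z x * g k)
    + B * (bernstein_alpha alpha r.+2 (k%:Z - 1) x * g k))); last by move=> k _; rewrite -[X in _ * X]/(g k); ring.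
  rewrite big_split; congr (_ + _); rewrite -mulr_sumr; congr (_ * _).
    by rewrite big_ord_recr /= ltnSn mul0r addr0.
  have shift (j : nat) : bernstein_alpha alpha r.+2 (j.+1%:Z - 1) x
      = bernstein_alpha alpha r.+2 j%:Z x by rewrite -(addn1 j) PoszD addrK.
  rewrite big_ord_recl [X in X + _](_ : _ = 0) ?add0r; last by rewrite /= mul0r.
  by apply: eq_bigr => k _; rewrite lift0 shift.
clearbody A B g.
rewrite (sum_bernstein_alpha alpha r x g).
by rewrite (sum_bernstein_alpha alpha r x (fun k => g k.+1)) -binomial_mean_linear.
Qed.

(** [T1] and [T2] are the exact values of the operator on [t - x] and
    [(t - x)^2], and the last factor bounds its value on [(t - x)^4]. *)
Lemma JM1_taylor {R : realType} (alpha rho : R) (a0 a1 : R^nat) (r : nat)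
    (f : R -> R) (x p q e C : R) :
  let n := r.+3 in
  let N := n%:R * rho in
  let X := x * (1 - x) in
  let b := acoef a0 a1 (1 - x) n in
  let T1 := (rho * (b - x) + 1 - 2 * x) / (N + 2) in
  let T2 := (rho ^+ 2 * (r%:R * X + (4 - 2 * alpha) * X + b * (1 - b) + (b - x) ^+ 2)
     + 3 * rho * (1 - 2 * x) * (b - x) + N * X + 2 - 6 * X) / ((N + 2) * (N + 3)) in
  0 < rho -> 0 <= alpha <= 1 -> 0 <= x <= 1 ->
  2 * a0 n + a1 n = 1 -> 0 <= a0 n -> 0 <= a0 n + a1 n -> 0 <= C ->
  {within `[0, 1], continuous f} ->
  (forall t, 0 <= t <= 1 ->
     `|f t - f x - p * (t - x) - q * (t - x) ^+ 2|
     <= e * (t - x) ^+ 2 + C * (t - x) ^+ 4) ->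
  `|JM1 alpha rho a0 a1 n f x - (f x + p * T1 + q * T2)|
  <= e * T2 + C * (32 / N ^+ 2 + 600 / n%:R ^+ 2).
Proof.
move=> n N X b T1 T2 rho0 al x01 hs h0 h01 C0 cf fle.
have N0 : 0 < N by rewrite mulr_gt0 // ltr0n.
have /andP[x0 x1] := x01.
have b0 : 0 <= b by rewrite /b /acoef; nra.
have A0 : 0 <= acoef a0 a1 x n by rewrite /acoef; nra.
have Ab : acoef a0 a1 x n + b = 1 by rewrite /b /acoef; lra.
rewrite JM1_index_mean.
set S := index_mean alpha (acoef a0 a1 x n) b r x.
pose v k := k%:R - n%:R * x : R.
pose E1 k := beta_avg rho n k (fun t => t - x).
pose E2 k := beta_avg rho n k (fun t => (t - x) ^+ 2).
pose E4 k := beta_avg rho n k (fun t => (t - x) ^+ 4).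
pose l1 k : R := (1 - 2 * x) / (N + 2) + rho / (N + 2) * v k + 0 * v k ^+ 2.
pose l2 k : R := (N * X + 2 - 6 * X) / ((N + 2) * (N + 3))
   + 3 * rho * (1 - 2 * x) / ((N + 2) * (N + 3)) * v k
   + rho ^+ 2 / ((N + 2) * (N + 3)) * v k ^+ 2.
pose l4 k : R := 32 / N ^+ 2 + 8 / n%:R ^+ 4 * v k ^+ 4.
have E1l k : (k <= n)%N -> E1 k = l1 k.
  move=> kn; rewrite /E1 beta_avg_central1 // /l1 -/N -/(v k); field; lra.
have E2l k : (k <= n)%N -> E2 k = l2 k.
  move=> kn; rewrite /E2 beta_avg_central2 // /l2 -/N -/(v k) -/X; field; lra.
have E4l k : (k <= n)%N -> E4 k <= l4 k.
  by move=> kn; exact: beta_avg_central4.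
have S1 : S (fun=> 1) = 1.
  have := index_mean_quadratic alpha r x 1 0 0 Ab; rewrite -/S !mul0r !addr0; apply: etrans.
  by apply: eq_index_mean => k; rewrite !mul0r !addr0.
have Sl1 : S l1 = T1.
  by rewrite /S /l1 /v index_mean_quadratic // /T1; field; lra.
have Sl2 : S l2 = T2.
  by rewrite /S /l2 /v index_mean_quadratic // /T2 -/X; field; lra.
have Sl4 : S l4 <= 32 / N ^+ 2 + 600 / n%:R ^+ 2.
  have := index_mean_fourth r al A0 b0 Ab x01; rewrite -/S -/n => H4.
  have -> : S l4 = 32 / N ^+ 2 * S (fun=> 1) + 8 / n%:R ^+ 4 * S (fun k => v k ^+ 4).
    by rewrite -index_mean_linear; apply: eq_index_mean => k; rewrite mulr1.
  rewrite S1 mulr1 lerD2l.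
  apply: (@le_trans _ _ (8 / n%:R ^+ 4 * (75 * n%:R ^+ 2))).
    by rewrite ler_wpM2l // divr_ge0 // exprn_ge0.
  by rewrite le_eqVlt; apply/predU1P; left; field; rewrite pnatr_eq0.
have lin c d g s : S (fun k => c * g k + d * s k) = c * S g + d * S s.
  exact: index_mean_linear.
pose M s w k := 1 * (1 * (f x * 1 + p * l1 k) + s * l2 k) + w * l4 k.
have SM s w : S (M s w) = f x + p * T1 + s * T2 + w * S l4.
  by rewrite /M !lin S1 Sl1 Sl2 !mul1r mulr1.
have bound k : (k <= n)%N ->
   M (q - e) (- C) k <= beta_avg rho n k f <= M (q + e) C k.
  move=> kn; have := beta_avg_taylor n k rho0 cf fle.
  rewrite -/(E1 k) -/(E2 k) -/(E4 k) E1l // E2l // ler_norml => /andP[lo hi].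
  have : C * E4 k <= C * l4 k by rewrite ler_wpM2l // E4l.
  by rewrite /M; move=> H; apply/andP; split; lra.
have up : S (fun k => beta_avg rho n k f) <= S (M (q + e) C).
  by apply: ler_index_mean => // k kn; case/andP: (bound _ kn).
have dn : S (M (q - e) (- C)) <= S (fun k => beta_avg rho n k f).
  by apply: ler_index_mean => // k kn; case/andP: (bound _ kn).
rewrite !SM in up dn.
have : C * S l4 <= C * (32 / N ^+ 2 + 600 / n%:R ^+ 2) by rewrite ler_wpM2l.
rewrite -/n -/b -/S => H; rewrite ler_norml; apply/andP; split; lra.
Qed.

(** Here [b] stands for [a0 n], and [(1 - 2 x) (1 - b)] is the mean deviation of
    the index. *)
Lemma first_moment_rate {R : realType} (rho n x b l : R) :
  let N := n * rho in
  0 < rho -> 1 <= n -> 0 <= x <= 1 -> 0 <= b <= 1 ->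
  `|n * ((1 - 2 * x) * (rho * (1 - b) + 1) / (N + 2))
    - (1 - 2 * x) * (rho * (1 - l) + 1) / rho|
  <= 2 * (rho + 1) / rho ^+ 2 / n + `|b - l|.
Proof.
move=> N rho0 n1 /andP[x0 x1] /andP[b0 b1].
have n0 : 0 < n by lra.
have N0 : 0 < N by rewrite mulr_gt0.
have x21 : `|1 - 2 * x| <= 1 by rewrite ler_norml; apply/andP; split; lra.
have -> : n * ((1 - 2 * x) * (rho * (1 - b) + 1) / (N + 2))
    - (1 - 2 * x) * (rho * (1 - l) + 1) / rho
  = (1 - 2 * x) * ((l - b) - 2 * (rho * (1 - b) + 1) / (rho * (N + 2))).
  by rewrite /N; field; rewrite !gt_eqF //; nra.
rewrite normrM; apply: (le_trans (y := 1 * `|(l - b) - 2 * (rho * (1 - b) + 1) / (rho * (N + 2))|)).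
  by rewrite ler_wpM2r.
rewrite mul1r (le_trans (ler_normB _ _)) // [X in X <= _]addrC distrC lerD2r.
have h0 : 0 <= 2 * (rho * (1 - b) + 1) by nra.
rewrite ger0_norm ?divr_ge0 //; last by rewrite mulr_ge0 //; lra.
rewrite ler_pdivrMr; last by rewrite mulr_gt0 //; lra.
have -> : 2 * (rho + 1) / rho ^+ 2 / n * (rho * (N + 2))
   = 2 * (rho + 1) + 4 * (rho + 1) / (rho * n).
  by rewrite /N; field; rewrite !gt_eqF.
have : 0 <= 4 * (rho + 1) / (rho * n) by rewrite divr_ge0 // ?mulr_ge0 //; lra.
nra.
Qed.

(** [n rho (rho + 1) X] is the leading part of the numerator of the second moment,
    for [X = x (1 - x)]: the index contributes [rho^2 n X] and the Beta density
    [rho n X].  [K] collects the bounded terms. *)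
Lemma second_moment_rate {R : realType} (rho n X K K0 : R) :
  let N := n * rho in
  0 < rho -> 1 <= n -> 0 <= X <= 1 -> `|K| <= K0 ->
  `|n * ((n * rho * (rho + 1) * X + K) / ((N + 2) * (N + 3)))
    - X * (1 + rho) / rho|
  <= ((1 + rho) * (5 * rho + 6) / rho ^+ 3 + K0 / rho ^+ 2) / n.
Proof.
move=> N rho0 n1 /andP[X0 X1] hK.
have n0 : 0 < n by lra.
have N0 : 0 < N by rewrite mulr_gt0.
have D0 : 0 < (N + 2) * (N + 3) by rewrite mulr_gt0 //; lra.
have -> : n * ((n * rho * (rho + 1) * X + K) / ((N + 2) * (N + 3)))
    - X * (1 + rho) / rho =
  (n * K - X * (1 + rho) / rho * (5 * N + 6)) / ((N + 2) * (N + 3)).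
  by rewrite /N; field; rewrite !gt_eqF //; nra.
rewrite normrM [X in _ * X]gtr0_norm ?invr_gt0 // ler_pdivrMr //.
have K00 : 0 <= K0 := le_trans (normr_ge0 _) hK.
have P0 : 0 <= (1 + rho) / rho by rewrite divr_ge0 //; lra.
apply: (@le_trans _ _ (n * K0 + (1 + rho) / rho * (5 * N + 6))).
  rewrite (le_trans (ler_normB _ _)) // lerD //.
    by rewrite normrM gtr0_norm // ler_pM2l.
  rewrite ger0_norm; last by rewrite mulr_ge0 // ?divr_ge0 ?mulr_ge0 //; lra.
  by rewrite ler_wpM2r //; [lra|rewrite -mulrA ler_piMl].
have C0 : 0 <= (1 + rho) * (5 * rho + 6) / rho ^+ 3 + K0 / rho ^+ 2.
  by rewrite addr_ge0 // divr_ge0 ?exprn_ge0 ?mulr_ge0 //; lra.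
apply: (@le_trans _ _ (((1 + rho) * (5 * rho + 6) / rho ^+ 3 + K0 / rho ^+ 2) / n * N ^+ 2)).
  have -> : ((1 + rho) * (5 * rho + 6) / rho ^+ 3 + K0 / rho ^+ 2) / n * N ^+ 2
     = n * K0 + (1 + rho) / rho * (5 * N + 6 * n).
    by rewrite /N; field; rewrite !gt_eqF.
  by rewrite lerD2l ler_wpM2l //; lra.
by rewrite ler_wpM2l ?divr_ge0 //; [lra|nra].
Qed.

(** * Voronovskaya estimate and convergence *)

(** The relation [2 a0 n + a1 n = 1] eliminates [a1]: both limits are expressed
    with [l], the limit of [a0].  The bound does not depend on [x]. *)
Lemma JM1_error_bound {R : realType} (alpha rho : R) (a0 a1 : R^nat) (l : R) (r : nat)
    (f f' f'' : R -> R) (x M1 M2 e C : R) :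
  let n := r.+3 in
  let C1 := 2 * (rho + 1) / rho ^+ 2 in
  let C2 := (1 + rho) * (5 * rho + 6) / rho ^+ 3
            + (2 * rho ^+ 2 + 3 * rho + 2) / rho ^+ 2 in
  0 < rho -> 0 <= alpha <= 1 -> 0 <= x <= 1 ->
  2 * a0 n + a1 n = 1 -> 0 <= a0 n -> 0 <= a0 n + a1 n ->
  0 <= e -> 0 <= C -> `|f' x| <= M1 -> `|f'' x| <= M2 ->
  {within `[0, 1], continuous f} ->
  (forall t, 0 <= t <= 1 ->
     `|f t - f x - f' x * (t - x) - f'' x / 2 * (t - x) ^+ 2|
     <= e * (t - x) ^+ 2 + C * (t - x) ^+ 4) ->
  `|n%:R * (JM1 alpha rho a0 a1 n f x - f x)
    - ((1 - 2 * x) * (rho * (1 - l) + 1) / rho * f' x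
       + x * (1 - x) * (1 + rho) / rho * (f'' x / 2))|
  <= e * ((1 + rho) / rho + C2)
     + (C * (32 / rho ^+ 2 + 600) + M1 * C1 + M2 * C2) / n%:R
     + M1 * `|a0 n - l|.
Proof.
move=> n C1 C2 rho0 al x01 hs h0 h01 e0 C0 hM1 hM2 cf fle.
have := JM1_taylor rho0 al x01 hs h0 h01 C0 cf fle; rewrite -/n.
have /andP[x0 x1] := x01; have /andP[al0 al1] := al.
set J := JM1 _ _ _ _ _ _ _.
set N := n%:R * rho; set X := x * (1 - x); set b := acoef _ _ _ _.
have n3 : 3 <= n%:R :> R by rewrite ler_nat.
have n1 : 1 <= n%:R :> R by lra.
have N0 : 0 < N by rewrite mulr_gt0 //; lra.
have a1E : a1 n = 1 - 2 * a0 n by lra.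
have bE : b = (1 - 2 * a0 n) * (1 - x) + a0 n by rewrite /b /acoef a1E.
have a01 : 0 <= a0 n <= 1 by apply/andP; split; lra.
have X0 : 0 <= X by rewrite mulr_ge0 //; lra.
have X4 : 4 * X <= 1 by rewrite /X; have := sqr_ge0 (1 - 2 * x); lra.
have X1 : 0 <= X <= 1 by apply/andP; split; lra.
have b0 : 0 <= b by rewrite bE; nra.
have b1 : b <= 1 by rewrite bE; nra.
have rE : r%:R = n%:R - 3 :> R by rewrite /n -addn3 natrD addrK.
(* The bounded part of the numerator of the second moment; the 3 variances
   missing from [r = n - 3] turn [4 - 2 alpha] into [1 - 2 alpha]. *)
pose K := rho ^+ 2 * ((1 - 2 * alpha) * X + b * (1 - b) + (b - x) ^+ 2)
  + 3 * rho * ((1 - 2 * x) * (b - x)) + 2 - 6 * X.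
have hK : `|K| <= 2 * rho ^+ 2 + 3 * rho + 2.
  have k1 : -1 <= (1 - 2 * alpha) * X + b * (1 - b) + (b - x) ^+ 2 <= 2.
    have h1 : -1 <= 4 * ((1 - 2 * alpha) * X) <= 1 by apply/andP; split; nra.
    have h2 : 0 <= b * (1 - b) by rewrite mulr_ge0 //; lra.
    have h3 : 4 * (b * (1 - b)) <= 1 by have := sqr_ge0 (1 - 2 * b); lra.
    have h4 : (b - x) ^+ 2 <= 1 by nra.
    have h5 := sqr_ge0 (b - x).
    by case/andP: h1 => h1 h1'; apply/andP; split; lra.
  have k2 : -1 <= (1 - 2 * x) * (b - x) <= 1 by apply/andP; split; nra.
  have r2 : 0 < rho ^+ 2 by rewrite exprn_gt0.
  rewrite /K ler_norml; case/andP: k1 => k1 k1'; case/andP: k2 => k2 k2'.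
  by apply/andP; split; nra.
set T1 := (rho * (b - x) + 1 - 2 * x) / (N + 2).
have -> : T1 = (1 - 2 * x) * (rho * (1 - a0 n) + 1) / (N + 2).
  by rewrite /T1; congr (_ / _); rewrite bE; ring.
set T2 := (X in _ + f'' x / 2 * X).
have T2E : T2 = (n%:R * rho * (rho + 1) * X + K) / ((N + 2) * (N + 3)).
  by rewrite /T2 rE; congr (_ / _); rewrite /K /N; ring.
have R1 := first_moment_rate (b := a0 n) l rho0 n1 x01 a01.
have R2 := second_moment_rate rho0 n1 X1 hK.
rewrite -T2E -/C2 in R2; rewrite -/N -/C1 in R1.
set U1 := (1 - 2 * x) * (rho * (1 - a0 n) + 1) / (N + 2) in R1 *.
set L1 := (1 - 2 * x) * (rho * (1 - l) + 1) / rho in R1 *.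
set L2 := X * (1 + rho) / rho in R2 *.
move=> HJ.
have nR : 0 < n%:R :> R by lra.
have {}HJ : `|n%:R * (J - (f x + f' x * U1 + f'' x / 2 * T2))|
   <= e * (n%:R * T2) + C * (32 / rho ^+ 2 + 600) / n%:R.
  rewrite normrM gtr0_norm //.
  have -> : e * (n%:R * T2) + C * (32 / rho ^+ 2 + 600) / n%:R
     = n%:R * (e * T2 + C * (32 / N ^+ 2 + 600 / n%:R ^+ 2)).
    by rewrite /N; field; rewrite !gt_eqF.
  by rewrite ler_pM2l.
have P0 : 0 <= (1 + rho) / rho by rewrite divr_ge0 //; lra.
have C20 : 0 <= C2.
  rewrite /C2 addr_ge0 // divr_ge0 ?exprn_ge0 ?(ltW rho0) //; first by nra.
  by have := sqr_ge0 rho; lra.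
have nT2 : n%:R * T2 <= (1 + rho) / rho + C2.
  have : C2 / n%:R <= C2 by rewrite ler_pdivrMr // ler_peMr.
  have : L2 <= (1 + rho) / rho by rewrite /L2 -mulrA ler_piMl //; case/andP: X1.
  by move: R2; rewrite ler_norml => /andP[_ R2]; lra.
have E1 : e * (n%:R * T2) <= e * ((1 + rho) / rho + C2) by rewrite ler_wpM2l.
have E2 : `|f' x * (n%:R * U1 - L1)| <= M1 * (C1 / n%:R + `|a0 n - l|).
  by rewrite normrM ler_pM.
have E3 : `|f'' x / 2 * (n%:R * T2 - L2)| <= M2 * (C2 / n%:R).
  rewrite normrM ler_pM // normrM (@ger0_norm _ 2^-1) ?invr_ge0 //.
  by have := normr_ge0 (f'' x); lra.
have -> : n%:R * (J - f x) - (L1 * f' x + L2 * (f'' x / 2))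
  = n%:R * (J - (f x + f' x * U1 + f'' x / 2 * T2))
    + f' x * (n%:R * U1 - L1) + f'' x / 2 * (n%:R * T2 - L2) by ring.
rewrite (le_trans (ler_normD _ _)) // (le_trans (lerD (ler_normD _ _) (lexx _))) //.
lra.
Qed.

Theorem theorem2 (R : realType) (alpha rho : R)
    (halpha : 0 <= alpha <= 1) (hrho : 0 < rho)
    (a0 a1 : R^nat) (l0 l1 : R)
    (ha0 : a0 n @[n --> \oo] --> l0) (ha1 : a1 n @[n --> \oo] --> l1)
    (hsum : forall n : nat, 2 * a0 n + a1 n = 1)
    (ha0_ge0 : forall n : nat, 0 <= a0 n)
    (ha01_ge0 : forall n : nat, 0 <= a0 n + a1 n)
    (f f' f'' : R -> R)
    (hf' : has_derivative_on `[0, 1] f f')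
    (hf'' : has_derivative_on `[0, 1] f' f'')
    (cf'' : {within `[0, 1], continuous f''}) :
  {uniform `[0, 1],
    (fun (n : nat) (x : R) => n%:R * (JM1 alpha rho a0 a1 n f x - f x)) @ \oo -->
    (fun x : R =>
       (1 - 2 * x) * ((rho + 2) * l0 + (rho + 1) * l1) / rho * f' x
       + x * (1 - x) * (1 + rho) * (2 * l0 + l1) / (2 * rho) * f'' x)}.
Proof.
have hl : 2 * l0 + l1 = 1.
  apply: (@cvg_unique _ _ ((fun n => 2 * a0 n + a1 n) @ \oo)) => //.
    by apply: cvgD => //; apply: cvgM => //; exact: cvg_cst.
  by rewrite (_ : (fun n => _) = fun=> 1); [exact: cvg_cst|apply/funext].
have cf := has_derivative_on_continuous hf'.
have [M1 M10 hM1] := within_bounded ler01 (has_derivative_on_continuous hf'').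
have [M2 M20 hM2] := within_bounded ler01 cf''.
pose C1 := 2 * (rho + 1) / rho ^+ 2.
pose C2 := (1 + rho) * (5 * rho + 6) / rho ^+ 3
            + (2 * rho ^+ 2 + 3 * rho + 2) / rho ^+ 2.
pose C3 := (1 + rho) / rho + C2.
have C30 : 0 < C3.
  have r2 := exprn_gt0 2 hrho; have r3 := exprn_gt0 3 hrho.
  by rewrite /C3 /C2 !addr_gt0 // divr_gt0 //; nra.
move=> P /uniform_nbhs[E [entE EP]].
have [eps eps0 ballE] : exists2 eps : R, 0 < eps & forall u v : R, `|u - v| < eps -> E (u, v).
  move: entE; rewrite -entourage_ballE => -[eps /= eps0 sub].
  by exists eps => // u v uv; apply: sub; rewrite /= -ball_normE.
(* [C3] bounds [n] times the second moment, so the Taylor remainder contributes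
   at most [e * C3], a quarter of [eps]. *)
pose e := eps / (4 * C3).
have e0 : 0 < e by rewrite divr_gt0 // mulr_gt0.
have [C C0 hC] := taylor2_bound ler01 hf' hf'' cf'' e0.
pose W := C * (32 / rho ^+ 2 + 600) + M1 * C1 + M2 * C2.
have ev : \forall n \near \oo, [/\ (3 <= n)%N, W / n%:R < eps / 4 & M1 * `|a0 n - l0| < eps / 4].
  have p4 : 0 < eps / 4 by rewrite divr_gt0.
  near=> n; split.
  - by near: n; exact: nbhs_infty_ge.
  - have n0 : (0 < n)%N by near: n; exact: nbhs_infty_gt.
    rewrite ltr_pdivrMr ?ltr0n // mulrC -ltr_pdivrMr //.
    by near: n; exact: nbhs_infty_gtr.
  - rewrite mulrC -ltr_pdivlMr // distrC; near: n.
    by move/cvgrPdist_lt: ha0; apply; rewrite divr_gt0.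
apply: filterS ev => n [n3 hW hM]; apply: EP => x /= x01; apply: ballE.
have x01' : 0 <= x <= 1 by move: x01; rewrite in_itv.
have l1E : l1 = 1 - 2 * l0 by lra.
have [r nE] : exists r, n = r.+3 by exists (n - 3)%N; rewrite -addn3 subnK.
have := @JM1_error_bound R alpha rho a0 a1 l0 r f f' f'' x M1 M2 e C hrho halpha
  x01' (hsum _) (ha0_ge0 _) (ha01_ge0 _) (ltW e0) (ltW C0) (hM1 _ x01) (hM2 _ x01) cf.
rewrite -nE => /(_ _) H.
rewrite distrC; apply: le_lt_trans (_ : _ < eps).
  rewrite [X in _ - X](_ : _ = (1 - 2 * x) * (rho * (1 - l0) + 1) / rho * f' x +
     x * (1 - x) * (1 + rho) / rho * (f'' x / 2)).
    by apply: H => t t01; apply: hC => //; rewrite in_itv.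
  by rewrite l1E; field; rewrite gt_eqF.
rewrite -/C1 -/C2 -/C3 -/W.
have -> : e * C3 = eps / 4 by rewrite /e; field; rewrite gt_eqF.
lra.
Unshelve. all: by end_near. Qed.
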